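(* The analogue of van Lambalgen's theorem is false for the relation $\mathsf{Tp}$ in $\mathcal{R}$. That is, the equivalence $$\mathsf{Tp}(a\oplus b)\ \Leftrightarrow\ \bigl(\mathsf{Tp}(a)\ \&\ \mathsf{Tp}(b,a)\bigr)$$ is false in general: there exist reals $a,b\in\mathcal{P}(\omega)$ for which it fails.
   Context: Reals are elements of $\mathcal{P}(\omega)$. $\mathcal{R}=(\omega,\mathcal{P}(\omega),+,\cdot,<,\in,0,1)$ is the full standard model of second-order arithmetic, in the two-sorted language $L_2=\{+,\cdot,<,\in,0,1\}$. For a real $a$ and a finite tuple $\overline{b}$ of reals, $\mathsf{Tp}(a,\overline{b})$ (''$a$ is $\overline{b}$-typical'') means: for every $L_2$-formula $\phi(x,\overline{y})$ (with $x$, $\overline{y}$ ranging over reals) such that $\mathcal{R}\models\phi(a,\overline{b})$, $|\{x\in\mathcal{P}(\omega):\mathcal{R}\models\phi(x,\overline{b})\}|=2^{\aleph_0}$. $\mathsf{Tp}(a)$ means $\mathsf{Tp}(a,\emptyset)$ (no parameters). For $a,b\subseteq\omega$, $a\oplus b=\{2n:n\in a\}\cup\{2n+1:n\in b\}$. *)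

(* Defs.v *)
From mathcomp Require Import all_boot.
From mathcomp Require Import boolp classical_sets functions cardinality.

Set Implicit Arguments.
Unset Strict Implicit.
Unset Printing Implicit Defensive.

Local Open Scope classical_set_scope.
Local Open Scope card_scope.

Definition real := set nat.

Inductive term (n : nat) : Type :=
| Var of 'I_n
| Zero
| One
| Add of term n & term n
| Mul of term n & term n.

Arguments Zero {n}.
Arguments One {n}.

(* Well-scoped de Bruijn syntax: [form n m] is the type of L_2-formulas whose
   free variables are among n number variables and m set variables. Each
   quantifier binds index 0 of its sort and shifts the others. The logic has
   equality at both sorts. *)
Inductive form : nat -> nat -> Type :=
| EqN n m of term n & term n : form n m
| EqS n m of 'I_m & 'I_m : form n m
| Lt n m of term n & term n : form n m
| Mem n m of term n & 'I_m : form n m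
| Not n m of form n m : form n m
| And n m of form n m & form n m : form n m
| Or n m of form n m & form n m : form n m
| Imp n m of form n m & form n m : form n m
| AllN n m of form n.+1 m : form n m
| ExN n m of form n.+1 m : form n m
| AllS n m of form n m.+1 : form n m
| ExS n m of form n m.+1 : form n m.

Fixpoint eval n (e : n.-tuple nat) (t : term n) : nat :=
  match t with
  | Var i => tnth e i
  | Zero => 0
  | One => 1
  | Add t1 t2 => eval e t1 + eval e t2
  | Mul t1 t2 => eval e t1 * eval e t2
  end.

(* Satisfaction in the full standard model (omega, P(omega), +, *, <, in, 0, 1). *)
Fixpoint sat n m (f : form n m) : n.-tuple nat -> m.-tuple real -> Prop :=
  match f in form n m return n.-tuple nat -> m.-tuple real -> Prop with
  | EqN _ _ t1 t2 => fun e s => eval e t1 = eval e t2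
  | EqS _ _ i j => fun e s => tnth s i = tnth s j
  | Lt _ _ t1 t2 => fun e s => eval e t1 < eval e t2
  | Mem _ _ t i => fun e s => tnth s i (eval e t)
  | Not _ _ g => fun e s => ~ sat g e s
  | And _ _ g h => fun e s => sat g e s /\ sat h e s
  | Or _ _ g h => fun e s => sat g e s \/ sat h e s
  | Imp _ _ g h => fun e s => sat g e s -> sat h e s
  | AllN _ _ g => fun e s => forall k : nat, sat g [tuple of k :: e] s
  | ExN _ _ g => fun e s => exists k : nat, sat g [tuple of k :: e] s
  | AllS _ _ g => fun e s => forall x : real, sat g e [tuple of x :: s]
  | ExS _ _ g => fun e s => exists x : real, sat g e [tuple of x :: s]
  end.

(* phi(x, y_1, ..., y_k) has no free number variable; x has index 0. *)
Definition holds k (phi : form 0 k.+1) (x : real) (b : k.-tuple real) : Prop :=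
  sat phi [tuple] [tuple of x :: b].

Definition Tp (a : real) k (b : k.-tuple real) : Prop :=
  forall phi : form 0 k.+1, holds phi a b ->
    [set x : real | holds phi x b] #= [set: real].

Definition join (a b : real) : real :=
  [set n.*2 | n in a] `|` [set n.*2.+1 | n in b].

(* Main.v *)
Require Import Defs.
From mathcomp Require Import all_boot.
From mathcomp Require Import boolp classical_sets functions cardinality.

(** The implication from left to right fails, because typicality of a join does
    not pass to its components.  If [b] varies over all reals, then
    [join set0 b] varies over continuum many reals; the parameter-free
    definable sets of fewer than continuum many reals are countably many, so by
    König's theorem (the continuum has uncountable cofinality) they do not
    cover this family ([full_not_covered], [full_set_has_typical]).  Hence
    some [join set0 b] is typical, whereas [set0] is not: it is the only
    element of a definable singleton ([not_typical_set0]).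

    Countability of the set of formulas is obtained from a decoding
    of finite trees which reaches every formula ([form_enum_surj]). *)

Set Implicit Arguments.
Unset Strict Implicit.
Unset Printing Implicit Defensive.

Local Open Scope classical_set_scope.
Local Open Scope card_scope.

(** * Countably many formulas *)

Notation code := (GenTree.tree nat).
Notation leaf := (@GenTree.Leaf nat).
Notation node := (@GenTree.Node nat).

Fixpoint term_code n (t : term n) : code :=
  match t with
  | Var i => leaf i
  | Zero => node 0 [::]
  | One => node 1 [::]
  | Add t u => node 2 [:: term_code t; term_code u]
  | Mul t u => node 3 [:: term_code t; term_code u]
  end.

Fixpoint term_decode n (c : code) : term n :=
  match c with
  | GenTree.Leaf i => if insub i is Some j then Var j else Zero
  | GenTree.Node 1 _ => One
  | GenTree.Node 2 [:: c; d] => Add (term_decode n c) (term_decode n d)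
  | GenTree.Node 3 [:: c; d] => Mul (term_decode n c) (term_decode n d)
  | _ => Zero
  end.

Lemma term_codeK n : cancel (@term_code n) (@term_decode n).
Proof. by elim=> //= [i|t -> u ->|t -> u ->] //; rewrite valK. Qed.

Fixpoint form_code n m (f : form n m) : code :=
  match f with
  | EqN _ _ t u => node 0 [:: term_code t; term_code u]
  | EqS _ _ i j => node 1 [:: leaf i; leaf j]
  | Lt _ _ t u => node 2 [:: term_code t; term_code u]
  | Defs.Mem _ _ t i => node 3 [:: term_code t; leaf i]
  | Not _ _ g => node 4 [:: form_code g]
  | And _ _ g h => node 5 [:: form_code g; form_code h]
  | Or _ _ g h => node 6 [:: form_code g; form_code h]
  | Imp _ _ g h => node 7 [:: form_code g; form_code h]
  | AllN _ _ g => node 8 [:: form_code g]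
  | ExN _ _ g => node 9 [:: form_code g]
  | AllS _ _ g => node 10 [:: form_code g]
  | ExS _ _ g => node 11 [:: form_code g]
  end.

(** The scope [n], [m] is an argument of the decoding and not part of the code,
    so that a cancellation lemma can be proved by induction on formulas without
    any inversion in the indexed family [form]. Codes of no formula are sent to
    the arbitrary value [EqN Zero Zero]. *)
Fixpoint form_decode n m (c : code) : form n m :=
  match c with
  | GenTree.Node 1 [:: GenTree.Leaf i; GenTree.Leaf j] =>
      if (insub i, insub j) is (Some i, Some j) then EqS n i j
      else EqN m Zero Zero
  | GenTree.Node 3 [:: c; GenTree.Leaf i] =>
      if insub i is Some i then Defs.Mem (term_decode n c) i else EqN m Zero Zero
  | GenTree.Node 0 [:: c; d] => EqN m (term_decode n c) (term_decode n d)
  | GenTree.Node 2 [:: c; d] => Lt m (term_decode n c) (term_decode n d)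
  | GenTree.Node 4 [:: c] => Not (form_decode n m c)
  | GenTree.Node 5 [:: c; d] => And (form_decode n m c) (form_decode n m d)
  | GenTree.Node 6 [:: c; d] => Or (form_decode n m c) (form_decode n m d)
  | GenTree.Node 7 [:: c; d] => Imp (form_decode n m c) (form_decode n m d)
  | GenTree.Node 8 [:: c] => AllN (form_decode n.+1 m c)
  | GenTree.Node 9 [:: c] => ExN (form_decode n.+1 m c)
  | GenTree.Node 10 [:: c] => AllS (form_decode n m.+1 c)
  | GenTree.Node 11 [:: c] => ExS (form_decode n m.+1 c)
  | _ => EqN m Zero Zero
  end.

Lemma form_codeK n m : cancel (@form_code n m) (@form_decode n m).
Proof.
elim=> {}n {}m //=.
- by move=> t u; rewrite !term_codeK.
- by move=> i j; rewrite !valK.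
- by move=> t u; rewrite !term_codeK.
- by move=> t i; rewrite term_codeK valK.
- by move=> g ->.
- by move=> g -> h ->.
- by move=> g -> h ->.
- by move=> g -> h ->.
- by move=> g ->.
- by move=> g ->.
- by move=> g ->.
- by move=> g ->.
Qed.

Definition form_enum n m (k : nat) : form n m :=
  form_decode n m (odflt (leaf 0) (unpickle k)).

Lemma form_enum_surj n m (f : form n m) : exists k, form_enum n m k = f.
Proof.
by exists (pickle (form_code f)); rewrite /form_enum pickleK /= form_codeK.
Qed.

(** * Typical reals in sets of size continuum *)

Lemma card_preimage_le T U (g : T -> U) (A : set U) :
  injective g -> g @^-1` A #<= A.
Proof.
move=> g_inj; have /card_eqPle[_ gA] : [set g x | x in g @^-1` A] #= g @^-1` A.
  by apply: inj_card_eq => x y _ _ /g_inj.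
by apply: card_le_trans gA _; apply: subset_card_le => _ [x Ax <-].
Qed.

(** This is König's theorem for the continuum.  A real codes a sequence of
    reals, its columns.  If [g] injects the reals into [E], then the preimage
    of [S n] under [g] is too small for the [n]th columns of its elements to be
    all reals; a real whose [n]th column is, for each [n], one of the missing
    values has its image under [g] outside each [S n]. *)
Lemma full_not_covered (E : set real) (S : nat -> set real) :
    [set: real] #<= E -> (forall n, ~ ([set: real] #<= S n)) ->
  exists2 x, E x & forall n, ~ S n x.
Proof.
move=> /pcard_leP[g] smallS.
have g_inj : injective g by move=> x y gxy; apply: (@inj _ _ _ g); rewrite ?inE.
pose column (n : nat) (x : real) : real := [set k : nat | x (pickle (n, k))].
have missed n : exists y, forall x, S n (g x) -> column n x <> y.
  apply: contrapT => /forallNP hit; apply: (smallS n).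
  apply: card_le_trans (card_preimage_le (S n) g_inj).
  apply: card_le_trans (card_image_le (column n) _).
  apply: subset_card_le => y _; have /existsNP[x] := hit y.
  by move=> /not_implyP[Sx /contrapT xy]; exists x.
have [y yP] := choice missed.
pose x : real := [set p | exists n k : nat, p = pickle (n, k) /\ y n k].
exists (g x) => [|n Sx]; first exact: (@funS _ _ _ _ g).
apply: (yP n x Sx); apply/seteqP; split=> k /=.
  by move=> [_ [_ [/(pcan_inj pickleK) [<- <-]]]].
by move=> yk; exists n, k.
Qed.

(** A real that is not [b]-typical lies in a set of size below the continuum
    definable from [b], and there are only countably many such sets. *)
Lemma full_set_has_typical (E : set real) k (b : k.-tuple real) :
  [set: real] #<= E -> exists2 x, E x & Tp x b.
Proof.
move=> fullE; pose D n := [set x | holds (form_enum 0 k.+1 n) x b].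
(* Only the small definable sets are to be avoided; the others become empty,
   which keeps the family indexed by [nat]. *)
pose S n := if `[< [set: real] #<= D n >] then set0 else D n.
have smallS n : ~ ([set: real] #<= S n).
  rewrite /S; case: asboolP => // _.
  by rewrite card_le0 => /eqP/seteqP[/(_ set0 I)].
have [x Ex Sx] := full_not_covered fullE smallS.
exists x => // phi phix; have [n nphi] := form_enum_surj phi.
apply/card_eqPle; split; first exact: subset_card_le.
apply: contrapT => /asboolPn small; apply: (Sx n).
by rewrite /S /D nphi (negbTE small).
Qed.

(** * The counterexample *)

Lemma join_odd a b n : join a b n.*2.+1 <-> b n.
Proof.
split=> [[[m _ /(congr1 odd)]|[m bm []/double_inj <-]] | bn] //.
  by rewrite /= !odd_double.
by right; exists n.
Qed.

Lemma join_injr a : injective (join a).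
Proof.
move=> b c bc; apply/seteqP; split=> n.
  by move=> /(join_odd a); rewrite bc => /join_odd.
by move=> /(join_odd a); rewrite -bc => /join_odd.
Qed.

Lemma not_typical_set0 : ~ Tp set0 [tuple].
Proof.
pose phi : form 0 1 := AllN (Not (Defs.Mem (Var ord0) ord0)).
have phiP x : holds phi x [tuple] <-> x = set0.
  split=> [phix|->]; last by move=> n; rewrite /= /tnth /=.
  by apply/seteqP; split=> n // xn; case: (phix n).
move=> /(_ phi) /(_ ((phiP _).2 erefl)) /card_eqPle[_] /pcard_leP[f].
have f0 x : f x = set0 by apply/phiP; exact: (@funS _ _ _ _ f).
have /seteqP[_ /(_ 0 I)] // : set0 = [set: nat].
by apply: (@inj _ _ _ f); rewrite ?inE // [LHS]f0 [RHS]f0.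
Qed.

Theorem corollary3p8 :
  exists a b : real,
    ~ (Tp (join a b) [tuple] <-> Tp a [tuple] /\ Tp b [tuple a]).
Proof.
have full : [set: real] #<= range (join set0).
  have /card_eqPle[] // : range (join set0) #= [set: real].
  by apply: inj_card_eq => x y _ _ /join_injr.
have [_ [b _ <-] typ] := full_set_has_typical [tuple] full.
by exists set0, b => -[/(_ typ)[/not_typical_set0]].
Qed.
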